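(* Let $k\ge 0$ be an integer and let $m\in\mathbb Z$. The algebra $A=\mathrm{IDD}(K^k_\infty,m,0)$ (over $\mathbb C$, with multiplication $\diamond$ as defined in the context) is a conservative algebra, with additional multiplication $*$ given by the bilinear extension of $$e_i * e_j=\frac{(i+j-2m)!}{(i+j-m)!}\,\frac{i!}{(i-m)!}\,\frac{j!}{(j-m)!}\,e_{i+j-m}\qquad (i,j\ge k),$$ where the right-hand side is read as $0$ if $i<m$ or $j<m$.
   Context: For $m\in\mathbb Z$, $\mathrm{IDD}(K^k_\infty,m,0)$ is the complex algebra with basis $e_k,e_{k+1},e_{k+2},\ldots$ (where $e_i$ stands for the monomial $x^i$) and bilinear multiplication $e_i\diamond e_j=\frac{i!}{(i-m)!}e_{i+j-m}$ if $i\ge m$, and $e_i\diamond e_j=0$ if $i<m$. (Equivalently $e_i\diamond e_j=T^m(x^i)x^j$, where $T^m$ is the $m$-th derivative $\partial^m$ if $m>0$, the identity if $m=0$, and the $|m|$-fold iterate of the integral $\int x^i=\frac1{i+1}x^{i+1}$ if $m<0$; in general a product is replaced by $0$ if it is not a multiple of a basis monomial.) A vector space $V$ with bilinear multiplication $\cdot$ (written by juxtaposition) is a conservative algebra, with additional multiplication $*:V\times V\to V$ (bilinear), if for all $a,b,x,y\in V$: $$b\big(a(xy)-(ax)y-x(ay)\big)-a\big((bx)y\big)+\big(a(bx)\big)y+(bx)(ay)-a\big(x(by)\big)+(ax)(by)+x\big(a(by)\big)=-(a*b)(xy)+\big((a*b)x\big)y+x\big((a*b)y\big).$$ *)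

(* Defs.v *)
From HB Require Import structures.
From mathcomp Require Import all_boot all_order all_algebra.
From mathcomp Require Import finmap.
From mathcomp Require Import sesquilinear.
From mathcomp.multinomials Require Import monalg.

Set Implicit Arguments.
Unset Strict Implicit.
Unset Printing Implicit Defensive.

Import Order.TTheory GRing.Theory Num.Theory.
Local Open Scope ring_scope.

Section Conservative.
Variables (F : fieldType) (V : lmodType F).

Definition conservative_with (mul star : {bilinear V -> V -> V}) : Prop :=
  forall a b x y : V,
    mul b (mul a (mul x y) - mul (mul a x) y - mul x (mul a y))
    - mul a (mul (mul b x) y) + mul (mul a (mul b x)) y
    + mul (mul b x) (mul a y)
    - mul a (mul x (mul b y)) + mul (mul a x) (mul b y)
    + mul x (mul a (mul b y))
  = - mul (star a b) (mul x y) + mul (mul (star a b) x) y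
    + mul x (mul (star a b) y).

End Conservative.

Section BilinearExtension.
Variables (F : fieldType) (I : choiceType) (W : lmodType F).
Variable f : I -> I -> W.

Definition bilin_ext (u v : {malg F[I]}) : W :=
  \sum_(i <- msupp u) \sum_(j <- msupp v) (u@_i * v@_j) *: f i j.

Lemma bilin_extEw (D E : {fset I}) u v :
  (msupp u `<=` D)%fset -> (msupp v `<=` E)%fset ->
  bilin_ext u v = \sum_(i <- D) \sum_(j <- E) (u@_i * v@_j) *: f i j.
Proof.
move=> uD vE; rewrite /bilin_ext (big_fset_incl _ uD) /=.
  apply: eq_bigr => i _; rewrite (big_fset_incl _ vE) //= => j _ jv.
  by rewrite (mcoeff_outdom jv) mulr0 scale0r.
by move=> i _ iu; rewrite big1 // => j _; rewrite (mcoeff_outdom iu) mul0r scale0r.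
Qed.

Lemma bilin_ext_is_bilinear : bilinear_for *:%R *:%R bilin_ext.
Proof.
split=> [v|u] c x y.
- pose D := (msupp x `|` msupp y `|` msupp (c *: x + y))%fset.
  have sx : (msupp x `<=` D)%fset by rewrite /D -fsetUA fsubsetUl.
  have sy : (msupp y `<=` D)%fset.
    by rewrite /D -fsetUA fsetUCA fsubsetUl.
  have sc : (msupp (c *: x + y) `<=` D)%fset by rewrite /D fsubsetUr.
  have sv := fsubset_refl (msupp v).
  rewrite (bilin_extEw sx sv) (bilin_extEw sy sv) (bilin_extEw sc sv).
  rewrite /= scaler_sumr -big_split; apply: eq_bigr => i _ /=.
  rewrite scaler_sumr -big_split; apply: eq_bigr => j _ /=.
  by rewrite mcoeffD mcoeffZ mulrDl scalerDl scalerA mulrA.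
- pose D := (msupp x `|` msupp y `|` msupp (c *: x + y))%fset.
  have sx : (msupp x `<=` D)%fset by rewrite /D -fsetUA fsubsetUl.
  have sy : (msupp y `<=` D)%fset.
    by rewrite /D -fsetUA fsetUCA fsubsetUl.
  have sc : (msupp (c *: x + y) `<=` D)%fset by rewrite /D fsubsetUr.
  have su := fsubset_refl (msupp u).
  rewrite (bilin_extEw su sx) (bilin_extEw su sy) (bilin_extEw su sc).
  rewrite /= scaler_sumr -big_split; apply: eq_bigr => i _ /=.
  rewrite scaler_sumr -big_split; apply: eq_bigr => j _ /=.
  by rewrite mcoeffD mcoeffZ mulrDr scalerDl scalerA mulrCA.
Qed.

HB.instance Definition _ :=
  bilinear_isBilinear.Build F {malg F[I]} {malg F[I]} W _ _ bilin_ext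
    bilin_ext_is_bilinear.

Lemma bilin_extU i j : bilin_ext << i >> << j >> = f i j.
Proof.
by rewrite /bilin_ext !msuppU oner_eq0 !big_seq_fset1 !mcoeffUU mulr1 scale1r.
Qed.

End BilinearExtension.

Definition Kidx (k : nat) := {n : int | k%:Z <= n}.

(* The space with basis e_k, e_{k+1}, ... is the free module on Kidx k. *)
Notation Kinf F k := {malg F[Kidx k]}.

Section IDD.
Variables (F : fieldType) (k : nat) (m : int).

(* By convention [ebasis n] is 0 when n < k, i.e. when x^n is not one of the
   basis monomials. *)
Definition ebasis (n : int) : Kinf F k :=
  if insub n is Some i then << (i : Kidx k) >> else 0.

(* Only meaningful for 0 <= n; every use below is guarded accordingly. *)
Definition factz (n : int) : F := (`|n|%N)`!%:R.

Definition IDD_basis (i j : int) : Kinf F k :=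
  if m <= i then (factz i / factz (i - m)) *: ebasis (i + j - m) else 0.

Definition star_basis (i j : int) : Kinf F k :=
  if (m <= i) && (m <= j) then
    (factz (i + j - 2%:Z * m) / factz (i + j - m)
       * (factz i / factz (i - m)) * (factz j / factz (j - m)))
      *: ebasis (i + j - m)
  else 0.

Definition IDDmul : {bilinear Kinf F k -> Kinf F k -> Kinf F k} :=
  bilin_ext (fun i j : Kidx k => IDD_basis (val i) (val j)).

Definition IDDstar : {bilinear Kinf F k -> Kinf F k -> Kinf F k} :=
  bilin_ext (fun i j : Kidx k => star_basis (val i) (val j)).

Lemma ebasis_val (i : Kidx k) : ebasis (val i) = << i >>.
Proof. by rewrite /ebasis valK. Qed.

Lemma IDDmulE (i j : int) : k%:Z <= i -> k%:Z <= j ->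
  IDDmul (ebasis i) (ebasis j) =
  if m <= i then (factz i / factz (i - m)) *: ebasis (i + j - m) else 0.
Proof.
move=> ki kj; pose i' : Kidx k := Sub i ki; pose j' : Kidx k := Sub j kj.
have -> : ebasis i = << i' >> by exact: (ebasis_val i').
have -> : ebasis j = << j' >> by exact: (ebasis_val j').
exact: bilin_extU.
Qed.

Lemma IDDstarE (i j : int) : k%:Z <= i -> k%:Z <= j ->
  IDDstar (ebasis i) (ebasis j) =
  if (m <= i) && (m <= j) then
    (factz (i + j - 2%:Z * m) / factz (i + j - m)
       * (factz i / factz (i - m)) * (factz j / factz (j - m)))
      *: ebasis (i + j - m)
  else 0.
Proof.
move=> ki kj; pose i' : Kidx k := Sub i ki; pose j' : Kidx k := Sub j kj.
have -> : ebasis i = << i' >> by exact: (ebasis_val i').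
have -> : ebasis j = << j' >> by exact: (ebasis_val j').
exact: bilin_extU.
Qed.

End IDD.

(* Main.v *)
Require Import Defs.
From mathcomp Require Import all_boot all_order all_algebra.
From mathcomp Require Import reals complex.
From mathcomp Require Import sesquilinear.
From mathcomp.multinomials Require Import monalg.
From mathcomp Require Import zify ring.

(** Write [D] for the linear map sending [e_i] to [i! / (i - m)! x^(i - m)], and
    to [0] when [i < m]. Left multiplication by [a] is ordinary multiplication
    by the polynomial [D a]: it lowers no degree, so nothing is lost below degree
    [k], and all left multiplications commute. The coefficients of [*] are
    chosen so that [D (a * b) = D a D b], that is, [(a * b) y = a (b y)]
    ([IDDmul_star]); [*] is also commutative ([IDDstarC]).

    These two facts are all that conservativity needs
    ([conservative_with_mul_star]). As left multiplications commute, the nine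
    terms on the left of the conservativity identity cancel except for
    [(a (b x)) y], and the three terms on the right reduce to
    [((a * b) x) y], which is the same element. *)

Set Implicit Arguments.
Unset Strict Implicit.
Unset Printing Implicit Defensive.

Import Order.TTheory GRing.Theory Num.Theory.
Local Open Scope ring_scope.
Local Open Scope complex_scope.

(** A commutative [star] that turns into composition of left multiplications
    forces these to commute with each other, and this cancels the terms of the
    conservativity identity in pairs. *)
Lemma conservative_with_mul_star (F : fieldType) (V : lmodType F)
    (mul star : {bilinear V -> V -> V}) :
    (forall a b, star a b = star b a) ->
    (forall a b y, mul (star a b) y = mul a (mul b y)) ->
  conservative_with mul star.
Proof.
move=> starC mul_star a b x y.
have mulC c d z : mul c (mul d z) = mul d (mul c z).
  by rewrite -mul_star starC mul_star.
rewrite !linearBr /= (mulC a x (mul b y)) (mulC (mul a x)).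
rewrite (mulC a (mul b x)) (mulC b a (mul x y)) (mulC b x y) (mulC a x).
rewrite (mulC b x) (mulC b a y).
rewrite -(mul_star a b x) -(mul_star a b y) (mulC x).
set P := mul (star a b) (mul x y); set Q := mul b (mul (mul a x) y).
set N := mul (mul b x) (mul a y); set U := mul (mul (star a b) x) y.
rewrite (addrAC P (- Q)) subrr add0r; congr (_ + P).
by rewrite [LHS]addrC !addrA subrr add0r [- N + U]addrC addrNK addrC.
Qed.

(** Phrased for a predicate closed under linear combinations, so that identities
    linear in several variables can be reduced to the basis one variable at a
    time. *)
Lemma malg_linear_ind (F : fieldType) (I : choiceType)
    (P : {malg F[I]} -> Prop) :
    P 0 -> (forall c u v, P u -> P v -> P (c *: u + v)) ->
    (forall i, P << i >>) ->
  forall u, P u.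
Proof.
move=> P0 Plin Pbasis u; rewrite [u]monalgE.
elim/big_rec: _ => // i v _ Pv.
have -> : << u@_i *g i >> = u@_i *: << i >> :> {malg F[I]}.
  by apply/malgP => j; rewrite mcoeffZ !mcoeffU mulr_natr.
exact: Plin.
Qed.

Section BasisExtension.
Variables (F : fieldType) (I : choiceType).
Local Notation M := {malg F[I]}.
Variables mul star : {bilinear M -> M -> M}.

Lemma malg_commutative :
    (forall i j, star << i >> << j >> = star << j >> << i >>) ->
  forall a b, star a b = star b a.
Proof.
move=> starC; elim/malg_linear_ind=> [|c u v IHu IHv|i] b.
- by rewrite linear0l linear0r.
- by rewrite linearPl linearPr IHu IHv.
elim/malg_linear_ind: b => [|c u v IHu IHv|j].
- by rewrite linear0l linear0r.
- by rewrite linearPl linearPr IHu IHv.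
exact: starC.
Qed.

Lemma malg_mul_star :
    (forall i j l, mul (star << i >> << j >>) << l >>
                   = mul << i >> (mul << j >> << l >>)) ->
  forall a b y, mul (star a b) y = mul a (mul b y).
Proof.
move=> mul_star; elim/malg_linear_ind=> [|c u v IHu IHv|i] b y.
- by rewrite !linear0l.
- by rewrite !linearPl IHu IHv.
elim/malg_linear_ind: b y => [|c u v IHu IHv|j] y.
- by rewrite linear0r !linear0l linear0r.
- by rewrite linearPr !linearPl linearPr IHu IHv.
elim/malg_linear_ind: y => [|c u v IHu IHv|l].
- by rewrite !linear0r.
- by rewrite !linearPr IHu IHv.
exact: mul_star.
Qed.

End BasisExtension.

Section ProductIdentities.
Variables (F : numFieldType) (k : nat) (m : int).

Local Notation mul := (IDDmul F k m).
Local Notation star := (IDDstar F k m).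

Lemma factz_neq0 n : factz F n != 0.
Proof. by rewrite pnatr_eq0 -lt0n fact_gt0. Qed.

Lemma IDDstarC a b : star a b = star b a.
Proof.
apply: malg_commutative => i j; rewrite -(ebasis_val F i) -(ebasis_val F j).
rewrite (IDDstarE F m (valP i) (valP j)) (IDDstarE F m (valP j) (valP i)).
rewrite andbC [val j + val i]addrC.
by rewrite mulrAC.
Qed.

(** When [m <= i] and [m <= j], the product [e_i * e_j] is a multiple of
    [e_(i + j - m)], on which left multiplication brings the factor
    [(i + j - m)! / (i + j - 2 m)!]; the first factor of the coefficient of [*]
    is its inverse, and what is left is the product of the coefficients of
    [e_i] and [e_j]. In the other cases both sides vanish. *)
Lemma IDDmul_star_basis (i j l : int) :
    k%:Z <= i -> k%:Z <= j -> k%:Z <= l ->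
  mul (star (ebasis F k i) (ebasis F k j)) (ebasis F k l)
  = mul (ebasis F k i) (mul (ebasis F k j) (ebasis F k l)).
Proof.
have := @factz_neq0; have := @IDDmulE F k m; have := @IDDstarE F k m.
(* Only the product formulas matter from here on; the operations are made
   abstract because unification would otherwise unfold them. *)
move: mul star (ebasis F k) (factz F) => mu st e f stE muE f_neq0 ki kj kl.
rewrite (stE _ _ ki kj) (muE _ _ kj kl).
have [mi|im] := boolP (m <= i); have [mj|jm] := boolP (m <= j); rewrite /=.
- have kij : k%:Z <= i + j - m by lia.
  have kjl : k%:Z <= j + l - m by lia.
  rewrite linearZl linearZr /= (muE _ _ kij kl) (muE _ _ ki kjl) mi.
  have -> : m <= i + j - m by lia.
  have -> : i + j - m - m = i + j - 2%:Z * m by ring.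
  have -> : i + (j + l - m) - m = i + j - m + l - m by ring.
  rewrite !scalerA; apply: (congr1 (fun c => c *: _)).
  by field; rewrite !f_neq0.
- by rewrite linear0l linear0r.
- have kjl : k%:Z <= j + l - m by lia.
  by rewrite linear0l linearZr /= (muE _ _ ki kjl) (negPf im) scaler0.
- by rewrite linear0l linear0r.
Qed.

Lemma IDDmul_star a b y : mul (star a b) y = mul a (mul b y).
Proof.
apply: malg_mul_star => i j l.
rewrite -(ebasis_val F i) -(ebasis_val F j) -(ebasis_val F l).
exact: IDDmul_star_basis (valP i) (valP j) (valP l).
Qed.

End ProductIdentities.

Theorem theorem2p18 (R : realType) (k : nat) (m : int) :
  conservative_with (IDDmul R[i] k m) (IDDstar R[i] k m).
Proof.
exact: conservative_with_mul_star (@IDDstarC _ k m) (@IDDmul_star _ k m).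
Qed.
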